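(* Let $\sigma\ge 0$ be a constant, $f\in L_2(\Omega)$, $\psi_D\in H^1(\Omega)$, and let $u\in H^1(\Omega)$ be the weak solution of $$-\mathrm{div}(\mathbf A\nabla u)+\sigma u=f \ \text{ in }\Omega,\qquad u|_{\partial\Omega}=\psi_D .$$ Let $v$ be any function in $H^1(\Omega)$ satisfying $v|_{\partial\Omega}=\psi_D$, and let $\sigma_*>0$ be a number such that $$\|u-v\|_{L_2(\Omega)}^2\le \sigma_*^{-1}\,\|u-v\|_{\mathbf A}^2 .$$ Then for every $\mathbf z\in \mathbf H(\Omega,\mathrm{div})$, $$\|\nabla(v-u)\cdot\mathbf A\nabla(v-u)\|_{L_1(\Omega)}+\sigma\|v-u\|_{L_2(\Omega)}^2=|\!|\!|v-u|\!|\!|^2\ \le\ \Theta\Big[\,]\!|\mathbf A\nabla v+\mathbf z|\![_{\mathbf A^{-1}}^2+\theta\,\|f-\sigma v-\mathrm{div}\,\mathbf z\|_{L_2(\Omega)}^2\Big],$$ where, with $\kappa=\sigma/\sigma_*$, $$\Theta=\begin{cases}\dfrac{2}{1+\kappa}, & \sigma\in[0,\sigma_*],\\[2mm] 1, & \sigma>\sigma_*,\end{cases}\qquad \theta=\begin{cases}\dfrac1{\sigma_*}, & \sigma\in[0,\sigma_*],\\[2mm] \dfrac1\sigma, & \sigma>\sigma_*.\end{cases}$$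
   Context: $\Omega\subset\mathbb R^m$ is a domain with sufficiently smooth boundary $\partial\Omega$. $\mathbf A=\mathbf A(x)$ is a symmetric $m\times m$ matrix with sufficiently smooth coefficients such that, for constants $0<\mu_1,\mu_2$, $\mu_1\,\xi\cdot\xi\le \mathbf A(x)\xi\cdot\xi\le\mu_2\,\xi\cdot\xi$ for all $x\in\Omega$, $\xi\in\mathbb R^m$. Boundary values are understood in the sense of traces. Notation: $\|w\|_{\mathbf A}^2=\int_\Omega\nabla w\cdot\mathbf A\nabla w\,dx$; $|\!|\!|w|\!|\!|=(\|w\|_{\mathbf A}^2+\sigma\|w\|_{L_2(\Omega)}^2)^{1/2}$ (energy norm); $\mathbf L_2(\Omega)=(L_2(\Omega))^m$; $\mathbf H(\Omega,\mathrm{div})=\{\mathbf y\in\mathbf L_2(\Omega):\mathrm{div}\,\mathbf y\in L_2(\Omega)\}$; $]\!|\mathbf y|\![_{\mathbf A^{-1}}=\big(\int_\Omega\mathbf A^{-1}\mathbf y\cdot\mathbf y\,dx\big)^{1/2}$. The weak solution $u$ satisfies $u|_{\partial\Omega}=\psi_D$ and $\int_\Omega(\mathbf A\nabla u\cdot\nabla\phi+\sigma u\phi)\,dx=\int_\Omega f\phi\,dx$ for all $\phi\in H^1(\Omega)$ with $\phi|_{\partial\Omega}=0$. *)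

(* Defs.v *)
From HB Require Import structures.
From mathcomp Require Import all_boot all_order all_algebra.
From mathcomp Require Import all_classical all_reals all_analysis.

Set Implicit Arguments.
Unset Strict Implicit.
Unset Printing Implicit Defensive.

Import Order.TTheory GRing.Theory Num.Theory.
Import numFieldNormedType.Exports.

Local Open Scope classical_set_scope.
Local Open Scope ring_scope.

(* R^n is 'rV[R]_n, with its topology and normed structure from the library.
   It carries the sigma-algebra generated by the coordinates, as n.-tuple T
   does in the library; for T = R this is the Borel sigma-algebra. *)
Definition measure_rV_display : measure_display -> measure_display.
Proof. exact. Qed.

Section measurable_rV.
Context {d} {T : measurableType d}.
Variable n : nat.

Let coors : 'I_n -> 'rV[T]_n -> T := fun i x => x ord0 i.

Let rV_set0 : g_sigma_preimage coors set0.
Proof. exact: sigma_algebra0. Qed.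

Let rV_setC A : g_sigma_preimage coors A -> g_sigma_preimage coors (~` A).
Proof. exact: sigma_algebraC. Qed.

Let rV_bigcup (F : _^nat) : (forall i, g_sigma_preimage coors (F i)) ->
  g_sigma_preimage coors (\bigcup_i (F i)).
Proof. exact: sigma_algebra_bigcup. Qed.

HB.instance Definition _ := @isMeasurable.Build (measure_rV_display d)
  'rV[T]_n (g_sigma_preimage coors) rV_set0 rV_setC rV_bigcup.

End measurable_rV.

Lemma measurable_coord d (T : measurableType d) n (i : 'I_n) :
  measurable_fun [set: 'rV[T]_n] (fun x : 'rV[T]_n => x ord0 i).
Proof.
move=> _ Y mY; rewrite setTI; apply: sub_sigma_algebra => /=.
rewrite -bigcup_seq/=; exists i => /=; first by rewrite mem_index_enum.
by exists Y => //; rewrite setTI.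
Qed.

Lemma measurable_fun_rVP d1 d2 (T1 : measurableType d1)
    (T2 : measurableType d2) n (f : T1 -> 'rV[T2]_n) :
  (forall i, measurable_fun [set: T1] (fun x => f x ord0 i)) ->
  measurable_fun [set: T1] f.
Proof.
move=> mf; suff : g_sigma_preimage
    (fun i => (fun x : 'rV[T2]_n => x ord0 i) \o f) `<=` measurable.
  by rewrite g_sigma_preimage_comp => prefS _ A mA; apply: prefS; exists A.
apply: smallest_sub; first exact: sigma_algebra_measurable.
case: n => [|n] in f mf *; first by rewrite big_ord0.
rewrite -bigcup_mkord_ord; apply: bigcup_sub => i Ii.
by move=> A [B mB <-]; exact: mf.
Qed.

(* The measure on R^(1 + n) induced by the product of a measure on R and a
   measure on R^n through (x, y) |-> row_mx x y. *)
Section cons_measure.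
Context {d} {T : measurableType d} {R : realType}.
Variable n : nat.

Definition rV_cons (p : T * 'rV[T]_n) : 'rV[T]_n.+1 :=
  row_mx (const_mx p.1 : 'rV[T]_1) p.2.

Lemma rV_cons0 p : rV_cons p ord0 ord0 = p.1.
Proof.
by rewrite /rV_cons mxE; case: split_ordP => j; [rewrite mxE|move/(congr1 val)].
Qed.

Lemma rV_consS p (j : 'I_n) : rV_cons p ord0 (lift ord0 j) = p.2 ord0 j.
Proof.
rewrite /rV_cons mxE; case: split_ordP => k /(congr1 val)/=.
  by rewrite (ord1 k).
by rewrite /bump/= => -[] /val_inj ->.
Qed.

Lemma measurable_rV_cons : measurable_fun [set: T * 'rV[T]_n] rV_cons.
Proof.
apply: measurable_fun_rVP => i; case: (unliftP ord0 i) => [j|] ->.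
  rewrite (_ : (fun x => _) = (fun x : 'rV[T]_n => x ord0 j) \o snd); last first.
    by apply/funext => p /=; rewrite rV_consS.
  by apply: measurableT_comp => //; exact: measurable_coord.
rewrite (_ : (fun x => _) = fst)//.
by apply/funext => p /=; rewrite rV_cons0.
Qed.

Definition rV_split (x : 'rV[T]_n.+1) : T * 'rV[T]_n :=
  (x ord0 ord0, \row_j x ord0 (lift ord0 j)).

Lemma rV_consK : cancel rV_cons rV_split.
Proof.
move=> [a y]; rewrite /rV_split rV_cons0; congr pair.
by apply/rowP => j; rewrite mxE rV_consS.
Qed.

Lemma measurable_rV_split : measurable_fun [set: 'rV[T]_n.+1] rV_split.
Proof.
apply/measurable_fun_prod => /=; first exact: measurable_coord.
apply: measurable_fun_rVP => i.
rewrite (_ : (fun x => _) = (fun x : 'rV[T]_n.+1 => x ord0 (lift ord0 i))).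
  exact: measurable_coord.
by apply/funext => x; rewrite /= mxE.
Qed.

Variables (m1 : {sigma_finite_measure set T -> \bar R})
  (m2 : {sigma_finite_measure set 'rV[T]_n -> \bar R}).

Definition cons_measure : set 'rV[T]_n.+1 -> \bar R :=
  pushforward (m1 \x m2)%E rV_cons.

Let cons_measure0 : cons_measure set0 = 0%E.
Proof. by rewrite /cons_measure /pushforward preimage_set0 (measure0 (m1 \x m2)%E). Qed.

Let cons_measure_ge0 A : (0 <= cons_measure A)%E.
Proof. exact: (measure_ge0 (m1 \x m2)%E). Qed.

Let cons_measure_sigma_additive : semi_sigma_additive cons_measure.
Proof.
move=> F mF tF mUF; rewrite /cons_measure /pushforward preimage_bigcup.
have mpre A : measurable A -> measurable (rV_cons @^-1` A).
  by move=> mA; rewrite -[X in measurable X]setTI; exact: measurable_rV_cons.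
apply: measure_semi_sigma_additive.
- by move=> k; exact: mpre.
- apply/trivIsetP => /= i j _ _ ij; rewrite -preimage_setI.
  by move/trivIsetP : tF => /(_ i j Logic.I Logic.I ij) ->; rewrite preimage_set0.
- by rewrite -preimage_bigcup; exact: mpre.
Qed.

HB.instance Definition _ := isMeasure.Build _ _ _ cons_measure
  cons_measure0 cons_measure_ge0 cons_measure_sigma_additive.

Let cons_measure_sigma_finite : sigma_finite setT cons_measure.
Proof.
have /sigma_finiteP[F [TF ndF Foo]] := sigma_finiteT m1.
have /sigma_finiteP[G [TG ndG Goo]] := sigma_finiteT m2.
exists (fun k => rV_split @^-1` (F k `*` G k)).
  apply/seteqP; split => // x _.
  have [i _ Fi] : (\bigcup_i F i) (rV_split x).1 by rewrite -TF.
  have [j _ Gj] : (\bigcup_i G i) (rV_split x).2 by rewrite -TG.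
  exists (maxn i j) => //; split.
  - by move: (rV_split x).1 Fi; exact/subsetPset/ndF/leq_maxl.
  - by move: (rV_split x).2 Gj; exact/subsetPset/ndG/leq_maxr.
move=> k; have [mF Fk] := Foo k; have [mG Gk] := Goo k; split.
  rewrite -[X in measurable X]setTI; apply: measurable_rV_split => //.
  exact: measurableX.
rewrite /cons_measure /pushforward.
rewrite (_ : rV_cons @^-1` _ = F k `*` G k).
  by rewrite product_measure1E// lte_mul_pinfty// ge0_fin_numE.
by apply/funext => p; rewrite -[in RHS](rV_consK p).
Qed.

HB.instance Definition _ := @Measure_isSigmaFinite.Build _ _ _ cons_measure
  cons_measure_sigma_finite.

End cons_measure.

(* lebesgue_measure is a measure on measurableTypeR R, which is R with another
   display for its sigma-algebra; this is the same measure on R itself. *)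
Section lebesgue_R.
Variable R : realType.

Definition lebesgue_R : set R -> \bar R := @lebesgue_measure R.

Let lebesgue_R0 : lebesgue_R set0 = 0%E.
Proof. exact: (measure0 (@lebesgue_measure R)). Qed.

Let lebesgue_R_ge0 A : (0 <= lebesgue_R A)%E.
Proof. exact: (measure_ge0 (@lebesgue_measure R)). Qed.

Let lebesgue_R_sigma_additive : semi_sigma_additive lebesgue_R.
Proof. exact: (@measure_semi_sigma_additive _ _ _ (@lebesgue_measure R)). Qed.

HB.instance Definition _ := isMeasure.Build _ _ _ lebesgue_R
  lebesgue_R0 lebesgue_R_ge0 lebesgue_R_sigma_additive.

Let lebesgue_R_sigma_finite : sigma_finite setT lebesgue_R.
Proof. exact: (sigma_finiteT (@lebesgue_measure R)). Qed.

HB.instance Definition _ := @Measure_isSigmaFinite.Build _ _ _ lebesgue_R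
  lebesgue_R_sigma_finite.

End lebesgue_R.

Section lebesgue_rV.
Variable R : realType.

Fixpoint lebesgue_rV (n : nat) : {sigma_finite_measure set 'rV[R]_n -> \bar R} :=
  if n is k.+1 then
    cons_measure (@lebesgue_R R) (lebesgue_rV k)
  else dirac (0 : 'rV[R]_0).

Lemma lebesgue_rV_box n (A : 'I_n -> set R) : (forall i, measurable (A i)) ->
  lebesgue_rV n [set x | forall i, A i (x ord0 i)] =
  (\prod_(i < n) @lebesgue_measure R (A i))%E.
Proof.
elim: n A => [|n IH] A mA.
  by rewrite big_ord0/= diracE mem_set// => -[].
have mB : measurable [set x : 'rV[R]_n | forall i, A (lift ord0 i) (x ord0 i)].
  rewrite (_ : [set x | _] = \big[setI/setT]_(i < n)
    ((fun x : 'rV[R]_n => x ord0 i) @^-1` A (lift ord0 i))).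
    apply: bigsetI_measurable => i _; rewrite -[X in measurable X]setTI.
    exact: measurable_coord.
  rewrite -bigcap_seq/=; apply/seteqP; split => x /= H i.
    by move=> _; exact: H.
  by apply: H => /=; rewrite mem_index_enum.
rewrite big_ord_recl -IH// -[RHS](product_measure1E (@lebesgue_R R))//.
rewrite /= /cons_measure /pushforward; congr product_measure1.
apply/seteqP; split => p /=.
  move=> H; split; first by have := H ord0; rewrite rV_cons0.
  by move=> i; have := H (lift ord0 i); rewrite rV_consS.
move=> [H0 HS] i; case: (unliftP ord0 i) => [j|] ->.
  by rewrite rV_consS.
by rewrite rV_cons0.
Qed.

End lebesgue_rV.

Section calculus.
Variables (R : realType) (m : nat).
Implicit Types (Omega : set 'rV[R]_m) (f w : 'rV[R]_m -> R).

Definition dotv (x y : 'rV[R]_m) : R := \sum_i x ord0 i * y ord0 i.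

(* the product of M with the column vector of coordinates y, as a row *)
Definition mulmxv (M : 'M[R]_m) (y : 'rV[R]_m) : 'rV[R]_m := y *m M^T.

Definition partial (i : 'I_m) f (x : 'rV[R]_m) : R := 'D_(delta_mx ord0 i) f x.

Definition grad f (x : 'rV[R]_m) : 'rV[R]_m := \row_i partial i f x.

Definition iter_partial (s : seq 'I_m) f : 'rV[R]_m -> R := foldr partial f s.

(* C^infinity on the whole space: differentiability of the iterated partial
   derivatives of every order makes them all continuous *)
Definition smooth f :=
  forall (s : seq 'I_m) (x : 'rV[R]_m), differentiable (iter_partial s f) x.

Definition C1_on (U : set 'rV[R]_m) f := forall x, U x ->
  differentiable f x /\ forall i, {for x, continuous (partial i f)}.

Definition domain Omega := [/\ open Omega, connected Omega & Omega !=set0].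

(* Near each of its boundary points, Omega is the sublevel set of a C^1
   defining function without critical points. The boundary is written
   closure Omega `\` Omega, as Omega is meant to be open. *)
Definition C1_boundary Omega := forall x0, (closure Omega `\` Omega) x0 ->
  exists (U : set 'rV[R]_m) (g : 'rV[R]_m -> R),
    [/\ open U, U x0, C1_on U g, (forall x, U x -> grad g x != 0) &
        Omega `&` U = [set x | U x /\ g x < 0]].

(* phi \in C_c^infinity(Omega), extended by 0 *)
Definition test_function Omega (phi : 'rV[R]_m -> R) :=
  smooth phi /\ exists K, [/\ compact K, K `<=` Omega &
    forall x, ~ K x -> phi x = 0].

End calculus.

(* Functions on Omega are total functions on R^m of which only the values on
   Omega matter. A Sobolev function comes with a representative of its weak
   gradient, and a field of H(Omega, div) with one of its weak divergence. *)
Section spaces.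
Variables (R : realType) (m : nat) (Omega : set 'rV[R]_m).
Implicit Types (w d : 'rV[R]_m -> R) (y Dw : 'rV[R]_m -> 'rV[R]_m).

Local Notation mu := (lebesgue_rV R m).

Definition L2 w := measurable_fun Omega w /\
  (\int[mu]_(x in Omega) (w x ^+ 2)%:E < +oo)%E.

Definition L2v y := forall i, L2 (fun x => y x ord0 i).

Definition weak_gradient w Dw := forall phi, test_function Omega phi ->
  forall i, \int[mu]_(x in Omega) (w x * partial i phi x) =
    - \int[mu]_(x in Omega) (Dw x ord0 i * phi x).

Definition weak_divergence y d := forall phi, test_function Omega phi ->
  \int[mu]_(x in Omega) dotv (y x) (grad phi x) =
    - \int[mu]_(x in Omega) (d x * phi x).

(* w \in H^1(Omega) and \nabla w = Dw *)
Definition H1 w Dw := [/\ L2 w, L2v Dw & weak_gradient w Dw].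

(* y \in H(Omega, div) and div y = d *)
Definition Hdiv y d := [/\ L2v y, L2 d & weak_divergence y d].

(* For (w, Dw) in H^1(Omega), w vanishes on the boundary in the sense of
   traces: w is in H^1_0(Omega), the closure of C_c^infinity(Omega) in
   H^1(Omega), which is the kernel of the trace operator.
   The integrals are in \bar R, so that a divergent one is not read as 0. *)
Definition zero_trace w Dw := exists phi : nat -> 'rV[R]_m -> R,
  [/\ forall k, test_function Omega (phi k),
      (\int[mu]_(x in Omega) ((w x - phi k x) ^+ 2)%:E)%E @[k --> \oo] --> 0%E &
      (\int[mu]_(x in Omega)
         (dotv (Dw x - grad (phi k) x) (Dw x - grad (phi k) x))%:E)%E
         @[k --> \oo] --> 0%E].

Definition same_trace u Du w Dw :=
  zero_trace (fun x => u x - w x) (fun x => Du x - Dw x).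

Definition normL1 w : R := \int[mu]_(x in Omega) `|w x|.

Definition normL2 w : R := Num.sqrt (\int[mu]_(x in Omega) (w x ^+ 2)).

Section energy.
Variable A : 'rV[R]_m -> 'M[R]_m.

(* ||w||_A, as a function of the gradient Dw of w *)
Definition normA Dw : R :=
  Num.sqrt (\int[mu]_(x in Omega) dotv (Dw x) (mulmxv (A x) (Dw x))).

Definition normAinv y : R :=
  Num.sqrt (\int[mu]_(x in Omega) dotv (mulmxv (invmx (A x)) (y x)) (y x)).

Definition energy_norm (sigma : R) w Dw : R :=
  Num.sqrt (normA Dw ^+ 2 + sigma * normL2 w ^+ 2).

Definition elliptic (mu1 mu2 : R) :=
  [/\ forall x, Omega x -> (A x)^T = A x,
      forall i j, C1_on Omega (fun x => A x i j) &
      forall x xi, Omega x ->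
        mu1 * dotv xi xi <= dotv (mulmxv (A x) xi) xi <= mu2 * dotv xi xi].

(* u, with gradient Du, is the weak solution of - div (A \nabla u) + sigma u = f
   in Omega, u = psi on the boundary, where Dpsi is the gradient of psi *)
Definition weak_solution (sigma : R) (f psi : 'rV[R]_m -> R)
    (Dpsi : 'rV[R]_m -> 'rV[R]_m) u Du :=
  [/\ H1 u Du, same_trace u Du psi Dpsi &
      forall phi Dphi, H1 phi Dphi -> zero_trace phi Dphi ->
        \int[mu]_(x in Omega)
          (dotv (mulmxv (A x) (Du x)) (Dphi x) + sigma * u x * phi x) =
        \int[mu]_(x in Omega) (f x * phi x)].

End energy.
End spaces.

Section constants.
Variable R : realType.

Definition Theta (sigma sigma_star : R) : R :=
  if sigma <= sigma_star then 2 / (1 + sigma / sigma_star) else 1.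

Definition theta (sigma sigma_star : R) : R :=
  if sigma <= sigma_star then sigma_star^-1 else sigma^-1.

End constants.

(* Main.v *)
(* Write e = v - u, which has zero trace. Testing the weak formulation with e
   and adding the identity int z . grad e + int (div z) e = 0 gives
   |||e|||^2 = int (A grad v + z) . grad e - int (f - sigma v - div z) e.
   By Cauchy-Schwarz, in the A^-1/A duality for the first integral, this is at
   most (N + S / k)^(1/2) (||e||_A^2 + k ||e||^2)^(1/2) for every k > 0, where N
   and S are the two squared residuals. Take k = sigma if sigma > sigma_star; if
   not, take k = sigma_star and use the Friedrichs inequality to get
   ||e||_A^2 + sigma_star ||e||^2 <= Theta |||e|||^2. *)
Require Import Defs.
From mathcomp Require Import all_boot all_order all_algebra.
From mathcomp Require Import all_classical all_reals all_analysis.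
From mathcomp Require Import measurable_realfun ring lra.
Set Implicit Arguments.
Unset Strict Implicit.
Unset Printing Implicit Defensive.
Import Order.TTheory GRing.Theory Num.Theory.
Import numFieldNormedType.Exports.
Local Open Scope classical_set_scope.
Local Open Scope ring_scope.

(** * Measurability in R^n *)

Lemma measurable_rV_box d (T : measurableType d) n (B : 'I_n -> set T) :
  (forall i, measurable (B i)) ->
  measurable [set x : 'rV[T]_n | forall i, B i (x ord0 i)].
Proof.
move=> mB; rewrite (_ : [set x | _] = \big[setI/setT]_(i < n)
    ((fun x : 'rV[T]_n => x ord0 i) @^-1` B i)).
  apply: bigsetI_measurable => i _; rewrite -[X in measurable X]setTI.
  exact: measurable_coord.
rewrite -bigcap_seq/=; apply/seteqP; split => x /= H i.
  by move=> _; exact: H.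
by apply: H => /=; rewrite mem_index_enum.
Qed.

(** The sigma-algebra is generated by the coordinates, so openness has to be related to it: an open
    set is the countable union of the cubes it contains with rational centre and radius
    [1 / (k + 1)]. *)
Lemma open_measurable_rV (R : realType) n (U : set 'rV[R]_n) :
  open U -> measurable U.
Proof.
move=> oU.
pose box (p : 'rV[rat]_n * nat) := [set x : 'rV[R]_n |
  forall i, ball (ratr (p.1 ord0 i) : R) (p.2.+1%:R^-1) (x ord0 i)].
have mbox p : measurable (box p).
  apply: (measurable_rV_box (B := fun i => ball (ratr (p.1 ord0 i) : R) _)) => i.
  exact: measurable_ball.
rewrite (_ : U = \bigcup_p (if `[< box p `<=` U >] then box p else set0)).
  apply: countable_bigcupT_measurable => [|p]; first exact: countableP.
  by case: ifP.
apply/seteqP; split => [x Ux|x [p _]]; last by case: ifPn => // /asboolP; apply.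
have /nbhs_ballP[e /= e0 eU] : nbhs x U by exact: open_nbhs_nbhs.
(* The centre of the cube and any of its points differ by less than [1 / (k + 1)], and so do the
   centre and [x]; two such distances must stay below [e]. *)
have e20 : 0 < e / 2 by rewrite divr_gt0.
have [k _ /(_ k (leqnn k)) /= ke] := near_infty_natSinv_lt (PosNum e20).
have k0 : 0 < k.+1%:R^-1 :> R by rewrite invr_gt0.
have ex_q i : exists q : rat, ratr q \in `](x ord0 i), (x ord0 i + k.+1%:R^-1)[.
  by apply: rat_in_itvoo; rewrite ltrDl.
have /choice[q qx] := ex_q.
exists (\row_i q i, k) => //; rewrite ifT.
  move=> i /=; rewrite mxE -ball_normE/= distrC ltr_distl.
  move: (qx i); rewrite in_itv/=; move: (_^-1) (x _ _) (ratr _) => d a b; lra.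
apply/asboolP => y /= yq; apply: eU; split => // i j; rewrite (ord1 i).
move: (yq j) (qx j); rewrite mxE in_itv/= -!ball_normE/= !ltr_distl.
move: (_^-1) ke (x _ _) (y _ _) (ratr _) => d de a b c; lra.
Qed.

Lemma continuous_measurable_rV (R : realType) n (U : set 'rV[R]_n)
    (g : 'rV[R]_n -> R) :
  open U -> {in U, continuous g} -> measurable_fun U g.
Proof.
move=> oU /(continuous_inP _ oU) cg.
apply: (measurability _ (RGenOpens.measurableE R)).
move=> _ [_ [a [b ->] <-]]; apply: open_measurable_rV; apply: cg.
exact: interval_open.
Qed.

(** * Square-integrable functions and fields *)

Section square_integrable.
Variables (R : realType) (m : nat) (D : set 'rV[R]_m).
Hypothesis mD : measurable D.
Implicit Types (f g : 'rV[R]_m -> R) (y z : 'rV[R]_m -> 'rV[R]_m).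
Local Notation mu := (lebesgue_rV R m).
Local Notation integrableR f := (mu.-integrable D (EFin \o f)).

Lemma L2P f : L2 D f <-> measurable_fun D f /\ integrableR (fun x => f x ^+ 2).
Proof.
have absE : (\int[mu]_(x in D) `|(f x ^+ 2)%:E| =
    \int[mu]_(x in D) (f x ^+ 2)%:E)%E.
  by apply: eq_integral => x _; rewrite gee0_abs// lee_fin sqr_ge0.
split=> -[mf fi]; split=> //; last by case/integrableP: fi => _; rewrite absE.
apply/integrableP; split; last by rewrite absE.
by apply/measurable_EFinP; exact: measurable_funX.
Qed.

(** The product is dominated by [f ^+ 2 + g ^+ 2]. *)
Lemma L2_integrableM f g : L2 D f -> L2 D g -> integrableR (fun x => f x * g x).
Proof.
move=> /L2P[mf fi] /L2P[mg gi].
apply: (le_integrable mD) (integrableD mD fi gi) => [|x _].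
  by apply/measurable_EFinP; exact: measurable_funM.
rewrite /= lee_fin [leRHS]ger0_norm ?addr_ge0 ?sqr_ge0// ler_norml.
have := sqr_ge0 (f x - g x); have := sqr_ge0 (f x + g x); nra.
Qed.

Lemma L2_bounded_mul (b f : 'rV[R]_m -> R) (M : R) : measurable_fun D b ->
  (forall x, D x -> `|b x| <= M) -> L2 D f -> L2 D (fun x => b x * f x).
Proof.
move=> mb bM /L2P[mf fi]; apply/L2P; split; first exact: measurable_funM.
apply: (le_integrable mD) (integrableZl mD (M ^+ 2) fi) => [|x Dx].
  by apply/measurable_EFinP/measurable_funX; exact: measurable_funM.
rewrite /= lee_fin -exprMn !normrX lerXn2r ?nnegrE// !normrM ler_wpM2r//.
exact: le_trans (bM x Dx) (ler_norm M).
Qed.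

Lemma L2Z c f : L2 D f -> L2 D (fun x => c * f x).
Proof.
by move=> fL; apply: (@L2_bounded_mul (cst c) f `|c|) => //; exact: measurable_cst.
Qed.

Lemma L2D f g : L2 D f -> L2 D g -> L2 D (fun x => f x + g x).
Proof.
move=> fL gL; apply/L2P; split; first by apply: measurable_funD; [case: fL|case: gL].
have /L2P[_ fi] := fL; have /L2P[_ gi] := gL.
apply: (eq_integrable mD) (integrableD mD (integrableD mD fi gi)
  (integrableZl mD 2 (L2_integrableM fL gL))) => // x _ /=.
by rewrite -EFinM -!EFinD; congr EFin; ring.
Qed.

Lemma L2B f g : L2 D f -> L2 D g -> L2 D (fun x => f x - g x).
Proof.
move=> fL gL; rewrite (_ : (fun x => _) = fun x => f x + -1 * g x).
  by apply: L2D => //; exact: L2Z.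
by apply/funext => x; rewrite mulN1r.
Qed.

Lemma L2_sum n (F : 'I_n -> 'rV[R]_m -> R) :
  (forall i, L2 D (F i)) -> L2 D (fun x => \sum_i F i x).
Proof.
move=> FL.
suff H (s : seq 'I_n) : L2 D (fun x => \sum_(i <- s) F i x) by exact: H.
elim: s => [|i s IH].
  apply/L2P; under eq_fun do rewrite big_nil; split; first exact: measurable_cst.
  apply: (eq_integrable mD) (integrable0 _ _) => // x _.
  by rewrite /= big_nil expr0n.
rewrite (_ : (fun x => _) = fun x => F i x + \sum_(j <- s) F j x).
  exact: L2D.
by apply/funext => x; rewrite big_cons.
Qed.

Lemma L2vD y z : L2v D y -> L2v D z -> L2v D (fun x => y x + z x).
Proof.
by move=> yL zL i; under eq_fun do rewrite mxE; exact: L2D.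
Qed.

Lemma L2vB y z : L2v D y -> L2v D z -> L2v D (fun x => y x - z x).
Proof.
by move=> yL zL i; under eq_fun do rewrite !mxE; exact: L2B.
Qed.

Lemma L2v_mulmxv (M : 'rV[R]_m -> 'M[R]_m) (B : 'I_m -> 'I_m -> R) y :
  (forall i j, measurable_fun D (fun x => M x i j)) ->
  (forall i j x, D x -> `|M x i j| <= B i j) ->
  L2v D y -> L2v D (fun x => mulmxv (M x) (y x)).
Proof.
move=> mM MB yL i; rewrite (_ : (fun x => _) = fun x => \sum_j M x i j * y x ord0 j).
  by apply: L2_sum => j; apply: (L2_bounded_mul (M := B i j)) => //; exact: MB.
by apply/funext => x; rewrite mxE; apply: eq_bigr => j _; rewrite mxE mulrC.
Qed.

Lemma integrableR_dotv y z : L2v D y -> L2v D z ->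
  integrableR (fun x => dotv (y x) (z x)).
Proof.
move=> yL zL; rewrite (_ : _ \o _ =
  (fun x => \sum_(i <- index_enum 'I_m) (y x ord0 i * z x ord0 i)%:E)%E).
  by apply: integrable_sum => // i _; exact: L2_integrableM.
by apply/funext => x; rewrite /= /dotv sumEFin.
Qed.

End square_integrable.

(** * Cauchy-Schwarz inequalities by the discriminant *)

Lemma sqr_le_mul_of_quad_ge0 (R : realType) (a b c : R) : 0 <= a ->
  (forall t, 0 <= a * t ^+ 2 + 2 * b * t + c) -> b ^+ 2 <= a * c.
Proof.
move=> a0 H; have [aE|a_neq0] := eqVneq a 0.
  rewrite aE mul0r; case: (eqVneq b 0) => [->|b0]; first by rewrite expr0n.
  (* For [a = 0] the polynomial is affine, and this [t] gives it the value [-1]. *)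
  have := H (- (c + 1) / (2 * b)); rewrite aE.
  rewrite (_ : _ + c = -1) ?ler0N1//; last by field.
have ap : 0 < a by rewrite lt_neqAle eq_sym a_neq0.
(* The minimum of the polynomial is attained at [- b / a]. *)
have := H (- b / a); rewrite (_ : _ + c = (a * c - b ^+ 2) / a); last by field.
by rewrite pmulr_lge0 ?invr_gt0// subr_ge0.
Qed.

(** Integrating the pointwise inequality gives a nonnegative polynomial in [t] whose coefficients
    are the integrals. Keeping the three densities arbitrary covers scalar products, dot products
    and the A^-1/A duality at once. *)
Lemma Rintegral_quad_ge0 (R : realType) (m : nat) (D : set 'rV[R]_m)
    (a b c : 'rV[R]_m -> R) (mu := lebesgue_rV R m) : measurable D ->
  mu.-integrable D (EFin \o a) -> mu.-integrable D (EFin \o b) ->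
  mu.-integrable D (EFin \o c) -> (forall x, D x -> 0 <= a x) ->
  (forall x t, D x -> 0 <= a x * t ^+ 2 + 2 * b x * t + c x) ->
  (\int[mu]_(x in D) b x) ^+ 2 <= \int[mu]_(x in D) a x * \int[mu]_(x in D) c x.
Proof.
move=> mD ai bi ci a0 H; apply: sqr_le_mul_of_quad_ge0; first exact: Rintegral_ge0.
move=> t.
have ati : mu.-integrable D (EFin \o (fun x => t ^+ 2 * a x)).
  exact: (integrableZl mD (t ^+ 2) ai).
have bti : mu.-integrable D (EFin \o (fun x => 2 * t * b x)).
  exact: (integrableZl mD (2 * t) bi).
have abi : mu.-integrable D (EFin \o (fun x => t ^+ 2 * a x + 2 * t * b x)).
  exact: (integrableD mD ati bti).
rewrite [X in 0 <= X](_ : _ =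
  \int[mu]_(x in D) (t ^+ 2 * a x + 2 * t * b x + c x)).
  by apply: Rintegral_ge0 => x Dx; have := H x t Dx; congr (0 <= _); ring.
by rewrite RintegralD// RintegralD// !RintegralZl//; ring.
Qed.

(** * Elliptic matrices *)

Section dot_product.
Variables (R : realType) (m : nat).
Implicit Types (x y z : 'rV[R]_m) (M : 'M[R]_m).

Lemma dotvE x y : dotv x y = (x *m y^T) ord0 ord0.
Proof. by rewrite mxE; apply: eq_bigr => i _; rewrite mxE. Qed.

Lemma dotvC x y : dotv x y = dotv y x.
Proof. by apply: eq_bigr => i _; rewrite mulrC. Qed.

Lemma dotvDl x y z : dotv (x + y) z = dotv x z + dotv y z.
Proof. by rewrite !dotvE mulmxDl mxE. Qed.

Lemma dotvZl k x y : dotv (k *: x) y = k * dotv x y.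
Proof. by rewrite !dotvE -scalemxAl mxE. Qed.

Lemma dotvDr x y z : dotv x (y + z) = dotv x y + dotv x z.
Proof. by rewrite !(dotvC x) dotvDl. Qed.

Lemma dotvZr k x y : dotv x (k *: y) = k * dotv x y.
Proof. by rewrite !(dotvC x) dotvZl. Qed.

Lemma dotvNl x y : dotv (- x) y = - dotv x y.
Proof. by rewrite -scaleN1r dotvZl mulN1r. Qed.

Lemma dotvBl x y z : dotv (x - y) z = dotv x z - dotv y z.
Proof. by rewrite dotvDl dotvNl. Qed.

Lemma dotvBr x y z : dotv x (y - z) = dotv x y - dotv x z.
Proof. by rewrite !(dotvC x) dotvBl. Qed.

Lemma dotvv_ge0 x : 0 <= dotv x x.
Proof. by apply: sumr_ge0 => i _; rewrite -expr2 sqr_ge0. Qed.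

Lemma dotvv_eq0 x : (dotv x x == 0) = (x == 0).
Proof.
apply/eqP/eqP => [x0|->]; last by rewrite /dotv big1// => i _; rewrite mxE mul0r.
apply/rowP => i; rewrite mxE; apply/eqP; rewrite -sqrf_eq0 expr2; apply/eqP.
by move: x0 i isT; apply: psumr_eq0P => i _; rewrite -expr2 sqr_ge0.
Qed.

Lemma dotv_quad_ge0 x y t : 0 <= dotv x x * t ^+ 2 + 2 * dotv x y * t + dotv y y.
Proof.
have := dotvv_ge0 (t *: x + y).
by rewrite dotvDl !dotvDr !dotvZl !dotvZr (dotvC y x); congr (0 <= _); ring.
Qed.

Lemma mulmxvD M x y : mulmxv M (x + y) = mulmxv M x + mulmxv M y.
Proof. exact: mulmxDl. Qed.

Lemma mulmxvZ M k x : mulmxv M (k *: x) = k *: mulmxv M x.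
Proof. by rewrite /mulmxv scalemxAl. Qed.

Lemma mulmxvB M x y : mulmxv M (x - y) = mulmxv M x - mulmxv M y.
Proof. exact: mulmxBl. Qed.

Lemma dotv_mulmxv M x y : dotv (mulmxv M x) y = dotv x (mulmxv M^T y).
Proof. by rewrite !dotvE /mulmxv !trmxK trmx_mul !mulmxA. Qed.

Lemma dotv_delta M i j :
  dotv (mulmxv M (delta_mx ord0 i)) (delta_mx ord0 j) = M j i.
Proof.
by rewrite dotvE /mulmxv -rowE trmx_delta -colE !mxE.
Qed.

(** Polarization: 2 M_ij = q(e_i + e_j) - q(e_i) - q(e_j) for the quadratic form q of [M]. The bound
    depends on [c], [i] and [j] only, so it is uniform over a family of matrices. *)
Lemma sym_entry_bound M c i j : M^T = M ->
  (forall x, 0 <= dotv (mulmxv M x) x <= c * dotv x x) ->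
  `|M i j| <= c * (dotv (delta_mx ord0 i + delta_mx ord0 j : 'rV_m)
                        (delta_mx ord0 i + delta_mx ord0 j : 'rV_m) +
                   dotv (delta_mx ord0 i : 'rV_m) (delta_mx ord0 i : 'rV_m) +
                   dotv (delta_mx ord0 j : 'rV_m) (delta_mx ord0 j : 'rV_m)).
Proof.
move=> symM H; have := H (delta_mx ord0 i); have := H (delta_mx ord0 j).
have := H (delta_mx ord0 i + delta_mx ord0 j).
rewrite mulmxvD dotvDl 2!(dotvDr (mulmxv _ _)) !dotv_delta.
rewrite (_ : M j i = M i j); last by rewrite -[in LHS]symM mxE.
move: (dotv _ _) (dotv _ _) (dotv _ _) => a b d.
by rewrite !mulrDr ler_norml => *; lra.
Qed.

Section coercive.
Variables (M : 'M[R]_m) (c : R).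
Hypotheses (c_gt0 : 0 < c) (symM : M^T = M)
  (M_ge : forall x, c * dotv x x <= dotv (mulmxv M x) x).

(** A kernel vector [v] would satisfy [c * dotv v v <= 0]. *)
Lemma coercive_unitmx : M \in unitmx.
Proof.
rewrite unitmxE unitfE; apply/det0P => -[v v0 vM].
have := M_ge v; rewrite /mulmxv symM vM [dotv 0 v]dotvE mul0mx mxE.
by rewrite pmulr_rle0// le_eqVlt ltNge dotvv_ge0 orbF dotvv_eq0 (negbTE v0).
Qed.

Lemma mulmxvK x : mulmxv M (mulmxv (invmx M) x) = x.
Proof.
by rewrite /mulmxv -mulmxA -trmx_mul mulmxV ?coercive_unitmx// trmx1 mulmx1.
Qed.

Lemma coercive_ge0 x : 0 <= dotv (mulmxv M x) x.
Proof. by rewrite (le_trans _ (M_ge x))// mulr_ge0// ?dotvv_ge0// ltW. Qed.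

Lemma coercive_inv_ge0 x : 0 <= dotv (mulmxv (invmx M) x) x.
Proof. by rewrite -[X in dotv _ X]mulmxvK dotvC coercive_ge0. Qed.

(** With y = M^-1 x, coercivity reads c |y|^2 <= y . x; inserting this in |x - c y|^2 >= 0 leaves c
    (y . x) <= |x|^2. *)
Lemma coercive_inv_le x : dotv (mulmxv (invmx M) x) x <= c^-1 * dotv x x.
Proof.
set y := mulmxv _ x.
have cy : c * dotv y y <= dotv y x.
  by have := M_ge y; rewrite mulmxvK dotvC.
have := dotv_quad_ge0 y x (- c); have := ler_wpM2l (ltW c_gt0) cy.
rewrite ler_pdivlMl//; move: (dotv y y) (dotv y x) (dotv x x) => a b d; lra.
Qed.

(** The polynomial is the quadratic form of [M] at t M^-1 x + y. Its cross term is free of [M],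
    which is what makes the energy norm and the A^-1 norm dual. *)
Lemma coercive_inv_quad_ge0 x y t : 0 <=
  dotv (mulmxv (invmx M) x) x * t ^+ 2 + 2 * dotv x y * t + dotv y (mulmxv M y).
Proof.
have := coercive_ge0 (t *: mulmxv (invmx M) x + y).
rewrite mulmxvD mulmxvZ mulmxvK dotvDl !dotvDr !dotvZl !dotvZr.
rewrite [dotv (mulmxv M y) _]dotv_mulmxv symM mulmxvK.
rewrite (dotvC y x) (dotvC (mulmxv M y)) (dotvC x (mulmxv _ x)).
by congr (0 <= _); ring.
Qed.

End coercive.
End dot_product.

(** * Continuity of determinants and cofactors *)

Section matrix_continuity.
Variables (R : realType) (T : topologicalType) (x : T).

Lemma det_continuous n (F : T -> 'M[R]_n) :
  (forall i j, {for x, continuous (fun y => F y i j)}) ->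
  {for x, continuous (fun y => \det (F y))}.
Proof.
move=> cF; apply: cvg_big => // [|s _]; first exact: add_continuous.
apply: cvgM; first exact: cvg_cst.
apply: cvg_big => [|i _]; last exact: cF.
exact: mul_continuous.
Qed.

Lemma cofactor_continuous n (F : T -> 'M[R]_n) i j :
  (forall k l, {for x, continuous (fun y => F y k l)}) ->
  {for x, continuous (fun y => cofactor (F y) i j)}.
Proof.
move=> cF; apply: cvgM; first exact: cvg_cst.
apply: det_continuous => k l; rewrite /prop_for.
rewrite (_ : (fun y => _) = fun y => F y (lift i k) (lift j l)); first exact: cF.
by apply/funext => y; rewrite !mxE.
Qed.

Lemma continuousV_for (g : T -> R) : g x != 0 ->
  {for x, continuous g} -> {for x, continuous (fun y => (g y)^-1)}.
Proof. by move=> g0 cg; exact: cvgV. Qed.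

End matrix_continuity.

(** * Measurability and boundedness of A and its inverse *)

Section elliptic_coefficients.
Variables (R : realType) (m : nat) (D : set 'rV[R]_m) (A : 'rV[R]_m -> 'M[R]_m).
Variables (mu1 mu2 : R).
Hypotheses (oD : open D) (mu1_gt0 : 0 < mu1) (ellA : elliptic D A mu1 mu2).

Lemma elliptic_coef_continuous i j x : D x -> {for x, continuous (fun x => A x i j)}.
Proof.
by case: ellA => _ + _ Dx => /(_ i j x Dx)[? _]; exact: differentiable_continuous.
Qed.

Lemma measurable_elliptic_coef i j : measurable_fun D (fun x => A x i j).
Proof.
apply: continuous_measurable_rV => // x /set_mem.
exact: elliptic_coef_continuous.
Qed.

Lemma elliptic_sym x : D x -> (A x)^T = A x.
Proof. by case: ellA => + _ _; exact. Qed.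

Lemma elliptic_ge x y : D x -> mu1 * dotv y y <= dotv (mulmxv (A x) y) y.
Proof. by case: ellA => _ _ + Dx => /(_ x y Dx)/andP[]. Qed.

Lemma elliptic_ge0 x y : D x -> 0 <= dotv (mulmxv (A x) y) y.
Proof. by move=> Dx; apply: (coercive_ge0 mu1_gt0) => z; exact: elliptic_ge. Qed.

(** By Cramer's rule the entries are cofactors divided by the determinant, continuous on [D] because
    the determinant does not vanish there. *)
Lemma measurable_elliptic_inv i j : measurable_fun D (fun x => invmx (A x) i j).
Proof.
have A_unit x : D x -> A x \in unitmx.
  move=> Dx; apply: (coercive_unitmx mu1_gt0) => [|z]; first exact: elliptic_sym.
  exact: elliptic_ge.
apply: (eq_measurable_fun
    (fun x => (\det (A x))^-1 * cofactor (A x) j i)) => [x /set_mem Dx|].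
  by rewrite /invmx A_unit// !mxE.
apply: measurable_funM; apply: continuous_measurable_rV => // x /set_mem Dx.
  apply: (@continuousV_for _ _ x).
    by have := A_unit _ Dx; rewrite unitmxE unitfE.
  by apply: det_continuous => k l; exact: elliptic_coef_continuous.
by apply: cofactor_continuous => k l; exact: elliptic_coef_continuous.
Qed.

Lemma L2v_elliptic y : L2v D y -> L2v D (fun x => mulmxv (A x) (y x)).
Proof.
have mD := open_measurable_rV oD.
apply: (L2v_mulmxv mD) measurable_elliptic_coef _.
move=> i j x Dx; apply: sym_entry_bound (elliptic_sym Dx) _ => z.
rewrite elliptic_ge0//=; case: ellA => _ _ /(_ x z Dx)/andP[_]; exact.
Qed.

(** The lower ellipticity bound on A is an upper bound [mu1^-1] for the form of its inverse, so the
    entries of the inverse are bounded. *)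
Lemma L2v_elliptic_inv y : L2v D y -> L2v D (fun x => mulmxv (invmx (A x)) (y x)).
Proof.
have mD := open_measurable_rV oD.
apply: (L2v_mulmxv mD) measurable_elliptic_inv _.
move=> i j x Dx; have symA := elliptic_sym Dx.
have geA z := elliptic_ge z Dx.
apply: (sym_entry_bound (c := mu1^-1)) => [|z]; first by rewrite trmx_inv symA.
by rewrite (coercive_inv_ge0 mu1_gt0 symA geA) (coercive_inv_le mu1_gt0 symA geA).
Qed.

End elliptic_coefficients.

(** * Test functions *)

Section test_functions.
Variables (R : realType) (m : nat).
Implicit Types (phi chi g : 'rV[R]_m -> R) (D : set 'rV[R]_m).
Local Notation mu := (lebesgue_rV R m).

Lemma iter_partialB s phi chi : smooth phi -> smooth chi ->
  iter_partial s (phi - chi) = iter_partial s phi - iter_partial s chi.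
Proof.
move=> sphi schi; elim: s => [//|i s IH] /=; rewrite IH.
by apply/funext => x; apply: deriveB; exact/diff_derivable.
Qed.

Lemma smoothB phi chi : smooth phi -> smooth chi -> smooth (phi - chi).
Proof.
move=> sphi schi s x; rewrite iter_partialB//; exact: differentiableB.
Qed.

Lemma test_functionB D phi chi :
  test_function D phi -> test_function D chi -> test_function D (phi - chi).
Proof.
move=> [sphi [K [cK KD phi0]]] [schi [L [cL LD chi0]]]; split; first exact: smoothB.
exists (K `|` L); split; [exact: compactU|by move=> x []; [exact: KD|exact: LD]|].
move=> x /not_orP[nK nL]; rewrite (_ : (phi - chi) x = phi x - chi x)//.
by rewrite phi0// chi0// subrr.
Qed.

Lemma gradB phi chi x : smooth phi -> smooth chi ->
  grad (phi - chi) x = grad phi x - grad chi x.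
Proof.
move=> sphi schi; apply/rowP => i; rewrite !mxE.
exact: (congr1 (@^~ x) (iter_partialB [:: i] sphi schi)).
Qed.

Lemma smooth_continuous phi s : smooth phi -> continuous (iter_partial s phi).
Proof. by move=> sphi x; exact/differentiable_continuous. Qed.

(** The complement of [K] is open, so [phi] vanishes near [x] and not only at [x]. *)
Lemma partial_outside_compact K phi i x : compact K ->
  (forall y, ~ K y -> phi y = 0) -> ~ K x -> partial i phi x = 0.
Proof.
move=> cK phi0 nKx; rewrite /partial (@near_eq_derive _ _ _ _ (cst 0)) ?derive_cst//.
have oK : open (~` K).
  apply: closed_openC; apply: (compact_closed _ cK); exact: norm_hausdorff.
have : nbhs x (~` K) by exact: open_nbhs_nbhs.
by apply: filterS => y; exact: phi0.
Qed.

Lemma compact_continuous_bounded K g : compact K -> continuous g ->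
  exists M : R, forall x, K x -> `|g x| <= M.
Proof.
move=> cK cg; have [M [_ gM]] : bounded_set (g @` K).
  by apply/compact_bounded/continuous_compact => //; exact: continuous_subspaceT.
by exists (M + 1) => x Kx; apply: (gM (M + 1)); [rewrite ltrDl|exists x].
Qed.

(** The coordinates are bounded on [K], so [K] lies in a box [B] of finite measure, and [g ^+ 2] is
    dominated by a constant times the indicator of [B]. *)
Lemma compact_support_L2 D K g : measurable D -> compact K -> continuous g ->
  (forall x, ~ K x -> g x = 0) -> L2 D g.
Proof.
move=> mD cK cg g0.
have mg : measurable_fun setT g.
  by apply: continuous_measurable_rV => [|x _]; [exact: openT|exact: cg].
have [M gM] := compact_continuous_bounded cK cg.
have /choice[N KN] i := compact_continuous_bounded cK
  (@coord_continuous R 1 m ord0 i).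
pose B := [set x : 'rV[R]_m | forall i, `[- N i, N i]%classic (x ord0 i)].
have mB : measurable B.
  apply: (measurable_rV_box (B := fun i => `[- N i, N i]%classic)) => i.
  exact: measurable_itv.
have KB : K `<=` B by move=> x Kx i /=; rewrite in_itv/= -ler_norml KN.
have muB : (mu B < +oo)%E.
  rewrite (lebesgue_rV_box (A := fun i => `[- N i, N i]%classic)) => [|i].
    rewrite ltey_eq; apply/orP; left; apply: prode_fin_num => i _.
    by rewrite lebesgue_measure_itv/=; case: ifP.
  exact: measurable_itv.
have iB : mu.-integrable setT (EFin \o \1_B).
  apply/integrableP; split; first exact/measurable_EFinP/measurable_indic.
  rewrite (eq_integral (EFin \o \1_B)) => [|x _]; last by rewrite /= ger0_norm.
  by rewrite integral_indic// setIT.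
apply/L2P; split; first exact: measurable_funS mg.
apply: (integrableS measurableT) => //.
apply: (le_integrable measurableT) (integrableZl measurableT (M ^+ 2) iB).
  by apply/measurable_EFinP; exact: measurable_funX.
move=> x _ /=; rewrite lee_fin [leRHS]normrM indicE.
have [Kx|/g0 ->] := pselect (K x); last by rewrite expr0n normr0 mulr_ge0.
rewrite mem_set ?normr1 ?mulr1; last exact: KB.
rewrite !normrX lerXn2r ?nnegrE//.
exact: le_trans (gM _ Kx) (ler_norm M).
Qed.

Section on_measurable_set.
Variable D : set 'rV[R]_m.
Hypothesis mD : measurable D.

Lemma test_function_L2 phi : test_function D phi -> L2 D phi.
Proof.
move=> [sphi [K [cK _ phi0]]].
by apply: (compact_support_L2 mD cK) => //; exact: (@smooth_continuous _ [::]).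
Qed.

Lemma test_function_partial_L2 phi i : test_function D phi -> L2 D (partial i phi).
Proof.
move=> [sphi [K [cK _ phi0]]]; apply: (compact_support_L2 mD cK).
  exact: (@smooth_continuous _ [:: i]).
by move=> x; exact: partial_outside_compact.
Qed.

Lemma test_function_grad_L2 phi : test_function D phi -> L2v D (grad phi).
Proof.
by move=> tphi i; under eq_fun do rewrite mxE; exact: test_function_partial_L2.
Qed.

End on_measurable_set.
End test_functions.

(** * Functions of zero trace *)

(** This epsilon form lets the extended integrals in [zero_trace] be handled by real
    inequalities. *)
Lemma ge0_cvge0P (R : realType) (f : nat -> \bar R) : (forall k, 0 <= f k)%E ->
  f k @[k --> \oo] --> 0%E <->
  forall e : R, 0 < e -> \forall k \near \oo, (f k < e%:E)%E.
Proof.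
move=> f0; split=> [cf e e0|H B].
  by apply: (cf [set x | (x < e%:E)%E]); exact: (@open_ereal_lt' _ 0%E).
move=> B0; have /nbhs_ballP[e /= e0 eB] : nbhs (0 : R) (fun r => B r%:E) by [].
apply: filterS (H e e0) => k.
rewrite /=; have := f0 k; case: (f k) => [r| |]//=; rewrite lee_fin lte_fin => r0 re.
by apply: eB; rewrite -ball_normE/= sub0r normrN ger0_norm.
Qed.

Section sobolev.
Variables (R : realType) (m : nat) (D : set 'rV[R]_m).
Hypothesis oD : open D.
Implicit Types (w u v : 'rV[R]_m -> R) (Dw Du Dv z : 'rV[R]_m -> 'rV[R]_m).
Local Notation mu := (lebesgue_rV R m).
Let mD := open_measurable_rV oD.

Lemma weak_gradientB u Du v Dv : H1 D u Du -> H1 D v Dv ->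
  weak_gradient D (fun x => u x - v x) (fun x => Du x - Dv x).
Proof.
move=> [uL DuL gu] [vL DvL gv] phi tphi i.
have pL := test_function_L2 mD tphi; have dpL := test_function_partial_L2 mD i tphi.
under eq_Rintegral do rewrite mulrBl.
rewrite RintegralB//; [|exact: L2_integrableM..].
rewrite gu// gv//.
under [in RHS]eq_Rintegral do rewrite !mxE mulrBl.
by rewrite RintegralB//; [rewrite opprB addrC opprK|exact: L2_integrableM..].
Qed.

Lemma H1B u Du v Dv : H1 D u Du -> H1 D v Dv ->
  H1 D (fun x => u x - v x) (fun x => Du x - Dv x).
Proof.
move=> Hu Hv; case: (Hu) => uL DuL _; case: (Hv) => vL DvL _.
by split; [exact: L2B|exact: L2vB|exact: weak_gradientB].
Qed.

Lemma integral_le_double (p q s : 'rV[R]_m -> R) :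
  mu.-integrable D (EFin \o p) -> mu.-integrable D (EFin \o q) ->
  mu.-integrable D (EFin \o s) -> (forall x, s x <= 2 * p x + 2 * q x) ->
  (\int[mu]_(x in D) (s x)%:E <=
   2%:E * \int[mu]_(x in D) (p x)%:E + 2%:E * \int[mu]_(x in D) (q x)%:E)%E.
Proof.
move=> pi qi si H; rewrite -!integralZl// -integralD//; last 2 first.
- exact: (integrableZl mD).
- exact: (integrableZl mD).
apply: le_integral => //; first by apply: (integrableD mD); exact: (integrableZl mD).
by move=> x _; rewrite /= -!EFinM -EFinD lee_fin.
Qed.

Lemma cvge0_le_double (f g h : nat -> \bar R) :
  (forall k, 0 <= f k)%E -> (forall k, 0 <= g k)%E -> (forall k, 0 <= h k)%E ->
  (forall k, h k <= 2%:E * f k + 2%:E * g k)%E ->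
  f k @[k --> \oo] --> 0%E -> g k @[k --> \oo] --> 0%E -> h k @[k --> \oo] --> 0%E.
Proof.
move=> f0 g0 h0 H /(ge0_cvge0P f0) cf /(ge0_cvge0P g0) cg.
apply/(ge0_cvge0P h0) => e e0; have e40 : 0 < e / 4 by rewrite divr_gt0.
near=> k; apply: (le_lt_trans (H k)).
have : (f k < (e / 4)%:E)%E by near: k; exact: cf.
have : (g k < (e / 4)%:E)%E by near: k; exact: cg.
have := f0 k; have := g0 k.
case: (f k) => [a| |]//=; case: (g k) => [b| |]//= _ _.
by rewrite -!EFinM -EFinD !lte_fin => ? ?; lra.
Unshelve. all: by end_near. Qed.

(** The differences of the two approximating sequences converge, by |a - b|^2 <= 2 |a|^2 + 2 |b|^2
    under the integrals. *)
Lemma zero_traceB u Du v Dv : L2 D u -> L2v D Du -> L2 D v -> L2v D Dv ->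
  zero_trace D u Du -> zero_trace D v Dv ->
  zero_trace D (fun x => u x - v x) (fun x => Du x - Dv x).
Proof.
move=> uL DuL vL DvL [p [tp pu Dpu]] [q [tq qv Dqv]].
exists (fun k => p k - q k).
have tpL k := test_function_L2 mD (tp k); have tqL k := test_function_L2 mD (tq k).
have gpL k := test_function_grad_L2 mD (tp k).
have gqL k := test_function_grad_L2 mD (tq k).
have i2 w w' : L2 D w -> L2 D w' ->
    mu.-integrable D (EFin \o (fun x => (w x - w' x) ^+ 2)).
  by move=> wL w'L; have /L2P[] := L2B mD wL w'L.
have iv Dw Dw' : L2v D Dw -> L2v D Dw' ->
    mu.-integrable D (EFin \o (fun x => dotv (Dw x - Dw' x) (Dw x - Dw' x))).
  by move=> wL w'L; have wwL := L2vB mD wL w'L; exact: integrableR_dotv.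
split=> [k||]; first exact: test_functionB.
- apply: cvge0_le_double pu qv => k.
  + by apply: integral_ge0 => x _; rewrite lee_fin sqr_ge0.
  + by apply: integral_ge0 => x _; rewrite lee_fin sqr_ge0.
  + by apply: integral_ge0 => x _; rewrite lee_fin sqr_ge0.
  + apply: integral_le_double; [exact: i2|exact: i2| |move=> x].
      by apply: i2; exact: L2B.
    rewrite (_ : (p k - q k) x = p k x - q k x)//.
    have := sqr_ge0 (u x - p k x + (v x - q k x)); nra.
- apply: cvge0_le_double Dpu Dqv => k.
  + by apply: integral_ge0 => x _; rewrite lee_fin dotvv_ge0.
  + by apply: integral_ge0 => x _; rewrite lee_fin dotvv_ge0.
  + by apply: integral_ge0 => x _; rewrite lee_fin dotvv_ge0.
  + have gE x : grad (p k - q k) x = grad (p k) x - grad (q k) x.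
      by apply: gradB; [case: (tp k)|case: (tq k)].
    apply: integral_le_double; [exact: iv|exact: iv| |move=> x].
      by under [EFin \o _]eq_fun do rewrite /= gE; apply: iv; exact: L2vB.
    rewrite gE (_ : Du x - Dv x - _ = Du x - grad (p k) x - (Dv x - grad (q k) x)).
      move: (Du x - _) (Dv x - _) => a b.
      have := dotvv_ge0 (a + b).
      rewrite !dotvDl !dotvDr !dotvNl !(dotvC _ (- b)) !dotvNl (dotvC b a).
      move: (dotv _ _) (dotv _ _) (dotv _ _) => s t r; lra.
    by rewrite !opprD !opprK !addrA; congr (_ + _); rewrite addrAC.
Qed.

Lemma Rintegral_dotvB y Du Dv : L2v D y -> L2v D Du -> L2v D Dv ->
  \int[mu]_(x in D) dotv (y x) (Du x - Dv x) =
  \int[mu]_(x in D) dotv (y x) (Du x) - \int[mu]_(x in D) dotv (y x) (Dv x).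
Proof.
move=> yL DuL DvL; rewrite -RintegralB//; [|exact: integrableR_dotv..].
by apply: eq_Rintegral => x _; rewrite dotvBr.
Qed.

Lemma Rintegral_mulB y u v : L2 D y -> L2 D u -> L2 D v ->
  \int[mu]_(x in D) (y x * (u x - v x)) =
  \int[mu]_(x in D) (y x * u x) - \int[mu]_(x in D) (y x * v x).
Proof.
move=> yL uL vL; rewrite -RintegralB//; [|exact: L2_integrableM..].
by apply: eq_Rintegral => x _; rewrite mulrBr.
Qed.

Lemma Rintegral_mul_CauchySchwarz u v : L2 D u -> L2 D v ->
  (\int[mu]_(x in D) (u x * v x)) ^+ 2 <=
  \int[mu]_(x in D) (u x ^+ 2) * \int[mu]_(x in D) (v x ^+ 2).
Proof.
move=> uL vL; have /L2P[_ ui] := uL; have /L2P[_ vi] := vL.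
apply: Rintegral_quad_ge0 => //; first exact: L2_integrableM.
  by move=> x _; exact: sqr_ge0.
by move=> x t _; have := sqr_ge0 (u x * t + v x); congr (0 <= _); ring.
Qed.

Lemma Rintegral_dotv_CauchySchwarz y z : L2v D y -> L2v D z ->
  (\int[mu]_(x in D) dotv (y x) (z x)) ^+ 2 <=
  \int[mu]_(x in D) dotv (y x) (y x) * \int[mu]_(x in D) dotv (z x) (z x).
Proof.
move=> yL zL; apply: Rintegral_quad_ge0 => //; try exact: integrableR_dotv.
  by move=> x _; exact: dotvv_ge0.
by move=> x t _; exact: dotv_quad_ge0.
Qed.

(* Both sides are continuous for the convergence of test functions to w in
   H^1, and for a test function this is the definition of the divergence. *)
Lemma weak_divergence_zero_trace z d w Dw : Hdiv D z d -> L2 D w -> L2v D Dw ->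
  zero_trace D w Dw ->
  \int[mu]_(x in D) dotv (z x) (Dw x) = - \int[mu]_(x in D) (d x * w x).
Proof.
move=> [zL dL divz] wL DwL [p [tp pw Dpw]].
set X := LHS; set Y := Rintegral _ _ _.
pose Z := \int[mu]_(x in D) dotv (z x) (z x).
pose W := \int[mu]_(x in D) (d x ^+ 2).
have Z0 : 0 <= Z by apply: Rintegral_ge0 => x _; exact: dotvv_ge0.
have W0 : 0 <= W by apply: Rintegral_ge0 => x _; exact: sqr_ge0.
(* [X + Y] is the defect in the identity; it vanishes once its square is below every positive
   number. *)
suff H e : 0 < e -> (X + Y) ^+ 2 <= 2 * (Z + W) * e.
  apply/eqP; rewrite -subr_eq0 opprK -sqrf_eq0 eq_le sqr_ge0 andbT.
  have ZW : 0 < 2 * (Z + W) + 1 by lra.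
  apply/ler_addgt0Pr => e e0; rewrite add0r.
  (* The added 1 keeps the denominator positive when [Z] and [W] are both 0. *)
  have e'0 : 0 < e / (2 * (Z + W) + 1) by rewrite divr_gt0.
  apply: le_trans (H _ e'0) _.
  rewrite mulrCA; apply: ler_piMr; first exact: ltW.
  by rewrite ler_pdivrMr// mul1r lerDl.
move=> e0.
have near_e (g : 'rV[R]_m -> R) : mu.-integrable D (EFin \o g) ->
    (\int[mu]_(x in D) (g x)%:E < e%:E)%E -> \int[mu]_(x in D) g x <= e.
  move=> gi; rewrite /Rintegral -[X in (X < _)%E]fineK ?lte_fin; first exact: ltW.
  exact: integrable_fin_num gi.
have /(ge0_cvge0P _)/(_ e e0) Pw := pw.
have /(ge0_cvge0P _)/(_ e e0) DPw := Dpw.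
have [k [pe Dpe]] : exists k,
    (\int[mu]_(x in D) ((w x - p k x) ^+ 2)%:E < e%:E)%E /\
    (\int[mu]_(x in D)
      (dotv (Dw x - grad (p k) x) (Dw x - grad (p k) x))%:E < e%:E)%E.
  have : \forall k \near \oo,
    (\int[mu]_(x in D) ((w x - p k x) ^+ 2)%:E < e%:E)%E /\
    (\int[mu]_(x in D)
      (dotv (Dw x - grad (p k) x) (Dw x - grad (p k) x))%:E < e%:E)%E.
    near=> k; split; near: k.
      by apply: Pw => k; apply: integral_ge0 => x _; rewrite lee_fin sqr_ge0.
    by apply: DPw => k; apply: integral_ge0 => x _; rewrite lee_fin dotvv_ge0.
  by move=> /filter_ex.
have pL := test_function_L2 mD (tp k); have gL := test_function_grad_L2 mD (tp k).
have wpL := L2B mD wL pL; have DwpL := L2vB mD DwL gL.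
have pe' := near_e _ (proj2 (iffLR (L2P D _) wpL)) pe.
have Dpe' := near_e _ (integrableR_dotv mD DwpL DwpL) Dpe.
have := Rintegral_dotv_CauchySchwarz zL DwpL; rewrite Rintegral_dotvB// divz//.
have := Rintegral_mul_CauchySchwarz dL wpL; rewrite Rintegral_mulB//.
(* Here [T] is the integral of [d * p k], and that of z . grad (p k) is [- T]. The two errors are
   thus [X + T] and [Y - T], whose sum is [X + Y]. *)
rewrite -/X -/Y -/Z -/W opprK; set T := Rintegral _ _ _.
move=> hY hX.
have {}hY := le_trans hY (ler_wpM2l W0 pe').
have {}hX := le_trans hX (ler_wpM2l Z0 Dpe').
have := sqr_ge0 (X + T - (Y - T)); nra.
Unshelve. all: by end_near. Qed.

End sobolev.

(** * The majorant *)

Section majorant.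
Variables (R : realType) (a b N S P Q : R).
Hypotheses (a_ge0 : 0 <= a) (b_ge0 : 0 <= b) (N_ge0 : 0 <= N) (S_ge0 : 0 <= S).
Hypotheses (PNa : P ^+ 2 <= N * a) (QSb : Q ^+ 2 <= S * b).

(** A Cauchy-Schwarz inequality in the plane with weight [k]. The product on the right contains
    [N * a] and [S * b], which bound the two squares; its mixed terms have product
    [(N * a) * (S * b)], so by the arithmetic-geometric mean inequality they bound [2 * P * Q] in
    absolute value. *)
Lemma sqr_sub_le_mul k : 0 < k -> (P - Q) ^+ 2 <= (N + S / k) * (a + k * b).
Proof.
move=> k0; have kn0 : k != 0 by rewrite gt_eqF.
have U0 : 0 <= N * (k * b) by rewrite !mulr_ge0// ltW.
have V0 : 0 <= S / k * a by rewrite !mulr_ge0// invr_ge0 ltW.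
have PQ : `|2 * P * Q| <= N * (k * b) + S / k * a.
  rewrite -(@ler_pXn2r _ 2) ?nnegrE ?addr_ge0// real_normK ?num_real//.
  have : P ^+ 2 * Q ^+ 2 <= (N * (k * b)) * (S / k * a).
    rewrite (_ : _ * _ * _ = (N * a) * (S * b)); last by field.
    by rewrite ler_pM// sqr_ge0.
  have := sqr_ge0 (N * (k * b) - S / k * a).
  rewrite !exprMn; move: (N * _) (S / k * a) (P ^+ 2) (Q ^+ 2) => U V x y.
  nra.
have := ler_norm (- (2 * P * Q)); rewrite normrN => PQ'.
have -> : (N + S / k) * (a + k * b) = N * a + S * b + (N * (k * b) + S / k * a).
  by field.
have := PNa; have := QSb; have := le_trans PQ' PQ.
move: (N * a) (S * b) (_ + _ * a) => s t r; nra.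
Qed.

(** The squared energy E = a + sigma b equals [P - Q], so the weighted inequality bounds E^2 by a
    multiple of E, and one factor E cancels. The case E = 0 is separate: there the right-hand side
    is nonnegative. *)
Lemma energy_majorant sigma ss : 0 <= sigma -> 0 < ss -> b <= ss^-1 * a ->
  a + sigma * b = P - Q ->
  a + sigma * b <= Theta sigma ss * (N + theta sigma ss * S).
Proof.
move=> s0 ss0 ba E; have ssn0 : ss != 0 by rewrite gt_eqF.
have E0 : 0 <= a + sigma * b by rewrite addr_ge0// mulr_ge0.
rewrite /Theta /theta; case: ifPn => [les|]; last first.
  rewrite -ltNge => lts; have sig0 : 0 < sigma := lt_trans ss0 lts.
  have := sqr_sub_le_mul sig0; rewrite -E mul1r (mulrC _ S) expr2.
  have [->|En0] := eqVneq (a + sigma * b) 0.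
    by rewrite addr_ge0// mulr_ge0// invr_ge0.
  by rewrite ler_pM2r// lt_neqAle eq_sym En0.
set T := 2 / _.
have ks : 0 <= sigma / ss by rewrite divr_ge0// ltW.
have T0 : 0 <= T by rewrite divr_ge0// addr_ge0.
have NS0 : 0 <= N + S / ss by rewrite addr_ge0// divr_ge0// ltW.
(* With k = sigma / ss and t = ss b this amounts to (1 - k) (a - t) >= 0, which holds because k <= 1
   and t <= a. This is where the factor 2 / (1 + k) comes from. *)
have TE : a + ss * b <= T * (a + sigma * b).
  rewrite /T mulrAC ler_pdivlMr; last by rewrite ltr_pwDl.
  have ssb : ss * b <= a by rewrite -ler_pdivlMl.
  have k1 : sigma / ss <= 1 by rewrite ler_pdivrMr// mul1r.
  have -> : sigma * b = sigma / ss * (ss * b) by field.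
  move: (sigma / ss) (ss * b) ks k1 ssb => k t *; nra.
have := le_trans (sqr_sub_le_mul ss0) (ler_wpM2l NS0 TE).
rewrite -E (mulrC _ S) mulrA (mulrC _ T) expr2.
have [->|En0] := eqVneq (a + sigma * b) 0.
  by rewrite mulr_ge0// mulrC.
by rewrite ler_pM2r// lt_neqAle eq_sym En0.
Qed.

End majorant.

(** * The error identity and the resulting estimate *)

Unset Implicit Arguments.

Theorem theorem2p1 (R : realType) (m : nat) (m_gt0 : (0 < m)%N)
  (Omega : set 'rV[R]_m) (dom_Omega : domain Omega)
  (bnd_Omega : C1_boundary Omega)
  (A : 'rV[R]_m -> 'M[R]_m) (mu1 mu2 : R) (mu1_gt0 : 0 < mu1)
  (mu2_gt0 : 0 < mu2) (ellA : elliptic Omega A mu1 mu2)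
  (sigma : R) (sigma_ge0 : 0 <= sigma)
  (f : 'rV[R]_m -> R) (L2f : L2 Omega f)
  (psi : 'rV[R]_m -> R) (Dpsi : 'rV[R]_m -> 'rV[R]_m)
  (H1psi : H1 Omega psi Dpsi)
  (u : 'rV[R]_m -> R) (Du : 'rV[R]_m -> 'rV[R]_m)
  (sol_u : weak_solution Omega A sigma f psi Dpsi u Du)
  (v : 'rV[R]_m -> R) (Dv : 'rV[R]_m -> 'rV[R]_m)
  (H1v : H1 Omega v Dv) (tr_v : same_trace Omega v Dv psi Dpsi)
  (sigma_star : R) (sigma_star_gt0 : 0 < sigma_star)
  (friedrichs : normL2 Omega (fun x => u x - v x) ^+ 2 <=
    sigma_star^-1 * normA Omega A (fun x => Du x - Dv x) ^+ 2)
  (z : 'rV[R]_m -> 'rV[R]_m) (div_z : 'rV[R]_m -> R)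
  (Hz : Hdiv Omega z div_z) :
  let e := fun x => v x - u x in
  let De := fun x => Dv x - Du x in
  normL1 Omega (fun x => dotv (De x) (mulmxv (A x) (De x))) +
      sigma * normL2 Omega e ^+ 2 = energy_norm Omega A sigma e De ^+ 2 /\
  energy_norm Omega A sigma e De ^+ 2 <=
    Theta sigma sigma_star *
      (normAinv Omega A (fun x => mulmxv (A x) (Dv x) + z x) ^+ 2 +
       theta sigma sigma_star *
         normL2 Omega (fun x => f x - sigma * v x - div_z x) ^+ 2).
Proof.
move=> e De; have [oO _ _] := dom_Omega; have mO := open_measurable_rV oO.
have [H1u tr_u weak_u] := sol_u.
have [uL DuL _] := H1u; have [vL DvL _] := H1v; have [pL DpL _] := H1psi.
have [zL dL _] := Hz.
have eL : L2 Omega e := L2B mO vL uL.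
have DeL : L2v Omega De := L2vB mO DvL DuL.
(* The boundary datum [psi] cancels in (v - psi) - (u - psi). *)
have tr_e : zero_trace Omega e De.
  have := zero_traceB oO (L2B mO vL pL) (L2vB mO DvL DpL) (L2B mO uL pL)
    (L2vB mO DuL DpL) tr_v tr_u.
  congr zero_trace; apply/funext => x; rewrite /e /De opprB addrA subrK//.
have AL y : L2v Omega y -> L2v Omega (fun x => mulmxv (A x) (y x)).
  by move=> yL; apply: (L2v_elliptic oO mu1_gt0 ellA).
pose Y := fun x => mulmxv (A x) (Dv x) + z x.
pose r := fun x => f x - sigma * v x - div_z x.
have YL : L2v Omega Y by apply: (L2vD mO) => //; exact: AL.
have fvL : L2 Omega (fun x => f x - sigma * v x) by apply: (L2B mO) => //; exact: L2Z.
have rL : L2 Omega r by exact: (L2B mO).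
pose a := \int[lebesgue_rV R m]_(x in Omega) dotv (De x) (mulmxv (A x) (De x)).
pose b := \int[lebesgue_rV R m]_(x in Omega) (e x ^+ 2).
pose N := \int[lebesgue_rV R m]_(x in Omega) dotv (mulmxv (invmx (A x)) (Y x)) (Y x).
pose S := \int[lebesgue_rV R m]_(x in Omega) (r x ^+ 2).
pose P := \int[lebesgue_rV R m]_(x in Omega) dotv (Y x) (De x).
pose Q := \int[lebesgue_rV R m]_(x in Omega) (r x * e x).
have symA x : Omega x -> (A x)^T = A x := @elliptic_sym _ _ _ _ _ _ ellA x.
have geA x y : Omega x -> _ := @elliptic_ge _ _ _ _ _ _ ellA x y.
have a0 : 0 <= a.
  by apply: Rintegral_ge0 => x Ox; rewrite dotvC (elliptic_ge0 mu1_gt0 ellA).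
have b0 : 0 <= b by apply: Rintegral_ge0 => x _; exact: sqr_ge0.
have S0 : 0 <= S by apply: Rintegral_ge0 => x _; exact: sqr_ge0.
have N0 : 0 <= N.
  apply: Rintegral_ge0 => x Ox.
  by apply: (coercive_inv_ge0 mu1_gt0 (symA x Ox)) => y; exact: geA.
(* Squaring undoes [Num.sqrt] only on nonnegative numbers, hence the sign facts above. *)
have normAE : normA Omega A De ^+ 2 = a by rewrite sqr_sqrtr.
have normL2E : normL2 Omega e ^+ 2 = b by rewrite sqr_sqrtr.
have energyE : energy_norm Omega A sigma e De ^+ 2 = a + sigma * b.
  by rewrite sqr_sqrtr normAE normL2E// addr_ge0// mulr_ge0.
split.
  rewrite energyE normL2E; congr (_ + _); apply: eq_Rintegral => x /set_mem Ox.
  by rewrite ger0_norm// dotvC (elliptic_ge0 mu1_gt0 ellA).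
rewrite energyE -/Y -/r.
have -> : normAinv Omega A Y ^+ 2 = N by rewrite sqr_sqrtr.
have -> : normL2 Omega r ^+ 2 = S by rewrite sqr_sqrtr.
(* The Friedrichs hypothesis concerns u - v = -e; both of its sides are even. *)
have ba : b <= sigma_star^-1 * a.
  move: friedrichs; congr (_ <= _ * _).
    by rewrite -normL2E; congr (Num.sqrt _ ^+ 2); apply: eq_Rintegral => x _;
      rewrite -sqrrN opprB.
  rewrite -normAE; congr (Num.sqrt _ ^+ 2); apply: eq_Rintegral => x _.
  by rewrite -[Du x - Dv x]opprB -scaleN1r mulmxvZ dotvZl dotvZr !mulN1r opprK.
have AinvL : L2v Omega (fun x => mulmxv (invmx (A x)) (Y x)).
  exact: (L2v_elliptic_inv oO mu1_gt0 ellA).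
(* Cauchy-Schwarz in the A^-1/A duality, with pointwise densities A^-1 Y . Y, Y . De and De . A
   De. *)
have PNa : P ^+ 2 <= N * a.
  apply: Rintegral_quad_ge0 => //; try exact: integrableR_dotv.
  - by apply: integrableR_dotv => //; exact: AL.
  - by move=> x Ox; apply: (coercive_inv_ge0 mu1_gt0 (symA x Ox)) => y; exact: geA.
  - move=> x t Ox.
    by apply: (coercive_inv_quad_ge0 mu1_gt0 (symA x Ox)) => y; exact: geA.
have QSb : Q ^+ 2 <= S * b by exact: Rintegral_mul_CauchySchwarz.
apply: (energy_majorant a0 b0 N0 S0 PNa QSb) => //.
(* It remains to show [a + sigma * b = P - Q]. Writing every integral through two linear
   functionals, the pairings with [De] and with [e], turns this into an identity between numbers. *)
pose dual y := \int[lebesgue_rV R m]_(x in Omega) dotv (mulmxv (A x) (y x)) (De x).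
pose mass w := \int[lebesgue_rV R m]_(x in Omega) (w x * e x).
have iAy y : L2v Omega y -> (lebesgue_rV R m).-integrable Omega
    (EFin \o (fun x => dotv (mulmxv (A x) (y x)) (De x))).
  by move=> yL; apply: integrableR_dotv => //; exact: AL.
have iM w : L2 Omega w -> (lebesgue_rV R m).-integrable Omega
    (EFin \o (fun x => w x * e x)).
  by move=> wL; exact: L2_integrableM.
have aE : a = dual Dv - dual Du.
  rewrite /dual -RintegralB//; [|exact: iAy..].
  by apply: eq_Rintegral => x _; rewrite dotvC mulmxvB dotvBl.
have bE : b = mass v - mass u.
  rewrite /mass -RintegralB//; [|exact: iM..].
  by apply: eq_Rintegral => x _; rewrite -mulrBl expr2.
have QE : Q = mass f - sigma * mass v - mass div_z.
  rewrite /mass -RintegralZl//; last exact: iM.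
  have isv : (lebesgue_rV R m).-integrable Omega
      (EFin \o (fun x => sigma * (v x * e x))).
    exact: (integrableZl mO sigma (iM _ vL)).
  rewrite -RintegralB//; [|exact: iM].
  rewrite -RintegralB//; [| |exact: iM].
    by apply: eq_Rintegral => x _; rewrite /r; ring.
  exact: (integrableB mO (iM _ L2f) isv).
(* Since [e] has zero trace, integrating z . De by parts leaves no boundary term. *)
have PE : P = dual Dv - mass div_z.
  rewrite /mass -(weak_divergence_zero_trace oO Hz eL DeL tr_e) -RintegralD//.
  - by apply: eq_Rintegral => x _; rewrite dotvDl.
  - exact: iAy.
  - exact: integrableR_dotv.
have solE : dual Du + sigma * mass u = mass f.
  rewrite [RHS](_ : _ = \int[lebesgue_rV R m]_(x in Omega) (f x * e x))//.
  rewrite -(weak_u e De (H1B oO H1v H1u) tr_e) -RintegralZl//; last exact: iM.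
  rewrite -RintegralD//.
  - by apply: eq_Rintegral => x _; rewrite mulrA.
  - exact: iAy.
  - exact: (integrableZl mO sigma (iM _ uL)).
(* The terms [mass div_z] of [P] and [Q] cancel, and the weak formulation tested with [e] replaces
   [mass f]. *)
rewrite aE bE PE QE -solE; ring.
Qed.
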